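(* Let $p$ be a positive integer, and let $H=([p],E)$ and $H'=([p],E')$ be two undirected graphs such that $E\subseteq E'$. Then $$\operatorname{conv}\left(c_{\mathcal{G}}\in\mathbb{R}^{2^p-p-1}\colon \mathcal{G}\text{ a DAG with skeleton } G=([p],D) \text{ where } E\subseteq D\subseteq E'\right)$$ is a face of the characteristic imset polytope $\operatorname{CIM}_p$.
   Context: All graphs are simple and $[p]=\{1,\dots,p\}$. A DAG is a directed acyclic graph. The skeleton of a directed graph is the undirected graph obtained by forgetting the directions of the edges. For a DAG $\mathcal{G}=([p],E)$ let $\operatorname{pa}_{\mathcal{G}}(i)=\{k\colon k\to i\in\mathcal{G}\}$. The characteristic imset of $\mathcal{G}$ is the function $c_{\mathcal{G}}\colon\{S\subseteq[p]\colon|S|\ge 2\}\to\{0,1\}$ given by $c_{\mathcal{G}}(S)=1$ if there exists $i\in S$ such that $j\in\operatorname{pa}_{\mathcal{G}}(i)$ for all $j\in S\setminus\{i\}$, and $c_{\mathcal{G}}(S)=0$ otherwise. It is identified with a vector in $\mathbb{R}^{2^p-p-1}$, whose coordinates are indexed by the sets $S\subseteq[p]$ with $|S|\geq 2$. The characteristic imset polytope is $\operatorname{CIM}_p=\operatorname{conv}(c_{\mathcal{G}}\in\mathbb{R}^{2^p-p-1}\colon\mathcal{G}=([p],E)\text{ a DAG})$. A face of a polytope is the set of points maximizing some linear functional over the polytope. *)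

(* Defs.v *)
From mathcomp Require Import all_boot all_order all_algebra.
From mathcomp Require Import boolp classical_sets reals convex.

Set Implicit Arguments.
Unset Strict Implicit.
Unset Printing Implicit Defensive.

Import Order.TTheory GRing.Theory Num.Theory.

Local Open Scope classical_set_scope.
Local Open Scope ring_scope.

(* The vertex set [p] = {1, ..., p} is 'I_p.  A simple undirected graph on [p]
   is given by its edge set, a set of 2-element subsets of [p]. *)
Definition ugraph (p : nat) (E : {set {set 'I_p}}) : bool :=
  [forall e in E, #|e| == 2%N].

(* A directed graph on [p] is given by its arc set: (i, j) stands for i -> j. *)
Definition darc (p : nat) (G : {set 'I_p * 'I_p}) : rel 'I_p :=
  [rel i j | (i, j) \in G].

(* [cycle] holds of closed directed walks and of the empty sequence.  Loops and
   pairs of opposite arcs are closed walks, so a DAG is a simple graph. *)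
Definition dag (p : nat) (G : {set 'I_p * 'I_p}) : Prop :=
  forall s : seq 'I_p, cycle (darc G) s -> s = [::].

Definition pa (p : nat) (G : {set 'I_p * 'I_p}) (i : 'I_p) : {set 'I_p} :=
  [set k | darc G k i]%SET.

Definition skeleton (p : nat) (G : {set 'I_p * 'I_p}) : {set {set 'I_p}} :=
  [set [set a.1; a.2] | a in G]%SET.

Definition imset_index (p : nat) : finType :=
  {S : {set 'I_p} | (2 <= #|S|)%N}.

(* The space R^(2^p - p - 1); R^o is R as a module over itself. *)
Definition imset_space (R : realType) (p : nat) : lmodType R :=
  {ffun imset_index p -> R^o}.

Definition char_imset (R : realType) (p : nat) (G : {set 'I_p * 'I_p}) :
    imset_space R p :=
  [ffun S : imset_index p =>
     [exists i in val S, [forall j in val S :\ i, j \in pa G i]]%:R : R^o].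
Arguments char_imset R {p} G.

Definition conv_hull (R : realType) (V : lmodType R) (A : set V) : set V :=
  smallest (@convex_set R V) A.

Definition CIM (R : realType) (p : nat) : set (imset_space R p) :=
  conv_hull (char_imset R @` [set G : {set 'I_p * 'I_p} | dag G]).
Arguments CIM R p : clear implicits.

Definition is_face (R : realType) (V : lmodType R) (F P : set V) : Prop :=
  exists f : {linear V -> R^o},
    F = [set x | P x /\ forall y, P y -> f y <= f x].

(* Main.v *)
(* The face is cut out by the functional x |-> #{e in E} - #{e not in E'},
   counted over the coordinates x_e with |e| = 2.  On c_G the coordinate x_e
   indicates whether e is an edge of the skeleton, so the value is at most |E|,
   with equality exactly when E is contained in the skeleton and the skeleton in
   E'.  The vertex order orients E acyclically, so the bound is attained. *)
Require Import Defs.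
From HB Require Import structures.
From mathcomp Require Import all_boot all_order all_algebra.
From mathcomp Require Import boolp classical_sets reals convex.
From mathcomp Require Import interval_inference lra.

Set Implicit Arguments.
Unset Strict Implicit.
Unset Printing Implicit Defensive.

Import Order.TTheory GRing.Theory Num.Theory.

Local Open Scope classical_set_scope.
Local Open Scope ring_scope.

Section Pairing.
Context (R : realType) (I : finType).

Definition pairing (w : I -> R) (x : {ffun I -> R^o}) : R^o :=
  \sum_i w i * x i.

Fact pairing_is_linear w : linear (pairing w).
Proof.
move=> a x y; rewrite /pairing scaler_sumr -big_split /=.
by apply: eq_bigr => i _; rewrite !ffunE mulrDr /GRing.scale /= mulrCA.
Qed.

HB.instance Definition _ w :=
  GRing.isLinear.Build R {ffun I -> R^o} R^o _ (pairing w) (pairing_is_linear w).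

End Pairing.
Arguments pairing {R I} w x.

Section ConvexHull.
Context (R : realType) (V : lmodType R).
Implicit Types (A : set V) (f : {linear V -> R^o}).

Lemma conv_hull_convex A : @convex_set R V (conv_hull A).
Proof.
move=> x y l /set_mem Ax /set_mem Ay; apply/mem_set => C [cC sAC].
by apply/set_mem/cC; apply/mem_set; [exact: Ax | exact: Ay].
Qed.

Lemma linear_conv f (x y : convex_lmodType V) (l : {i01 R}) :
  f (conv l x y) = l%:num * f x + (1 - l%:num) * f y.
Proof. by rewrite linearD !linearZ. Qed.

(** The right-hand set is convex and contains [A], hence contains the hull. Its two conditions go
    together: convexity of the second uses the bound at both endpoints. *)
Lemma conv_hull_max A f (m : R) : (forall a, A a -> f a <= m) ->
  conv_hull A `<=`
    [set x | f x <= m /\ (f x = m -> conv_hull [set a | A a /\ f a = m] x)].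
Proof.
move=> Am; apply: smallest_sub => [|a Aa]; last first.
  by split=> [|fa]; [exact: Am | exact: sub_gen_smallest].
(* Only weights strictly between 0 and 1 remain; there a combination of two values at most [m]
   equals [m] only if both do. *)
apply/convex_setW => x y /set_mem[xm xB] /set_mem[ym yB] l l0 l1.
apply/mem_set; rewrite /= linear_conv; split; first by nra.
move=> e; apply/set_mem/conv_hull_convex; apply/mem_set.
  by apply: xB; apply/eqP; rewrite eq_le xm /=; nra.
by apply: yB; apply/eqP; rewrite eq_le ym /=; nra.
Qed.

Lemma conv_hull_eq A f (m : R) : (forall a, A a -> f a = m) ->
  conv_hull A `<=` [set x | f x = m].
Proof.
move=> Am; apply: smallest_sub => // x y l /set_mem /= fx /set_mem /= fy.
by apply/mem_set; rewrite /= linear_conv fx fy; lra.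
Qed.

(** The point [a0] makes [m] the attained maximum, so every maximizer over the hull has value [m]
    and [conv_hull_max] applies to it. *)
Lemma is_face_conv_hull A f (m : R) a0 :
    (forall a, A a -> f a <= m) -> A a0 -> f a0 = m ->
  is_face (conv_hull [set a | A a /\ f a = m]) (conv_hull A).
Proof.
move=> Am Aa0 fa0; exists f; apply/seteqP; split=> x.
  move=> Bx; split.
    apply: sub_smallest2r Bx; first exact: conv_hull_convex.
    by move=> a [].
  have -> : f x = m by apply: conv_hull_eq Bx => a [].
  by move=> y /(conv_hull_max Am)[].
case=> Ax xmax; have [xm] := conv_hull_max Am Ax; apply.
apply/eqP; rewrite eq_le xm -fa0.
by apply: xmax; exact: sub_gen_smallest.
Qed.

End ConvexHull.

Section Skeleton.
Context (p : nat).
Implicit Types (G : {set 'I_p * 'I_p}) (E : {set {set 'I_p}}).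

Lemma dag_irrefl G i : dag G -> (i, i) \notin G.
Proof. by move=> dG; apply/negP => ii; have := dG [:: i]; rewrite /= /darc /= ii => /(_ isT). Qed.

Lemma ugraph_skeleton G : dag G -> ugraph (skeleton G).
Proof.
move=> dG; apply/forall_inP => _ /imsetP[[i j] ij ->] /=.
rewrite cards2; case: (eqVneq i j) => // eij.
by move: ij (dag_irrefl i dG); rewrite -eij => ->.
Qed.

Lemma skeletonP G i j :
  ([set i; j]%SET \in skeleton G) = ((i, j) \in G) || ((j, i) \in G).
Proof.
apply/imsetP/orP => [[[a b] ab /= /setP e]|[ij|ji]].
(* Since [G] may have loops, [i] and [j] may both equal one end of the arc; the memberships of [a]
   and [b] then identify its two ends. *)
- have := (e i, e j, e a, e b); rewrite !inE !eqxx ?orbT /=.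
  case=> [[[ei ej] ea] eb].
  case/esym/orP: ei => /eqP ?; case/esym/orP: ej => /eqP ?; subst; auto.
  + by move: eb; rewrite orbb => /eqP ?; subst; left.
  + by move: ea; rewrite orbb => /eqP ?; subst; left.
- by exists (i, j).
- by exists (j, i); rewrite //= finset.setUC.
Qed.

(** A vertex witnessing the value 1 is the head of an arc whose tail is the only other element of
    [S]. *)
Lemma char_imset_pair (R : realType) G (S : imset_index p) :
  #|val S| = 2%N -> char_imset R G S = (val S \in skeleton G)%:R.
Proof.
move/eqP/cards2P => [i [j [ij eS]]]; rewrite ffunE eS skeletonP; congr (nat_of_bool _)%:R.
have ji : j != i by rewrite eq_sym.
apply/exists_inP/orP.
  case=> k; rewrite !inE => /orP[]/eqP-> /forall_inP h; [right|left].
    by have := h j; rewrite !inE /= eqxx ji orbT; apply.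
  by have := h i; rewrite !inE /= eqxx ij; apply.
case=> h; [exists j | exists i]; rewrite ?inE ?eqxx ?orbT //;
  apply/forall_inP => k; rewrite !inE => /andP[/negPf->]; rewrite ?orbF /=;
  by move=> /eqP->.
Qed.

Definition order_orientation E : {set 'I_p * 'I_p} :=
  [set a : 'I_p * 'I_p | (a.1 < a.2)%N && ([set a.1; a.2]%SET \in E)]%SET.

(** Labels strictly increase along arcs, so a closed walk through [x] would give [x < x]. *)
Lemma dag_order_orientation E : dag (order_orientation E).
Proof.
case=> // x s /= xs.
have lt_trans : transitive (fun i j : 'I_p => (i < j)%N).
  by move=> j i k; apply: ltn_trans.
have : path (fun i j : 'I_p => (i < j)%N) x (rcons s x).
  by apply: sub_path xs => i j; rewrite /darc /= inE => /andP[].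
by move/(order_path_min lt_trans); rewrite all_rcons ltnn.
Qed.

Lemma skeleton_order_orientation E :
  ugraph E -> skeleton (order_orientation E) = E.
Proof.
move=> /forall_inP E2; apply/setP => e; apply/idP/idP.
  by case/imsetP=> a; rewrite inE => /andP[_ aE] ->.
move=> eE; have /cards2P[i [j [ij ee]]] := E2 e eE.
rewrite ee skeletonP !inE /= (finset.setUC [set j]%SET) -ee eE !andbT.
by rewrite -neq_ltn.
Qed.

End Skeleton.

Section EdgeFunctional.
Context (R : realType) (p : nat) (E E' : {set {set 'I_p}}).
Hypotheses (EG : ugraph E) (sEE' : E \subset E').

(** When [E \subset E'], required pairs get 1, optional ones 0 and forbidden ones -1. *)
Definition edge_weight (S : imset_index p) : R :=
  if #|val S| == 2%N then (val S \in E)%:R - (val S \notin E')%:R else 0.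

(** This is [#|E|] for a graph [E], written over the coordinates for a termwise comparison with
    [pairing]. *)
Definition edge_bound : R := \sum_(S : imset_index p) (val S \in E)%:R.

(** The bound holds in each coordinate [S], with equality exactly under [C S]; [leif_sum] adds these
    up. *)
Lemma edge_functional_max (G : {set 'I_p * 'I_p}) : dag G ->
  pairing edge_weight (char_imset R G) <= edge_bound
    ?= iff (E \subset skeleton G) && (skeleton G \subset E').
Proof.
move=> dG; pose C (S : imset_index p) :=
  ((val S \in E) ==> (val S \in skeleton G)) &&
  ((val S \in skeleton G) ==> (val S \in E')).
have -> : (E \subset skeleton G) && (skeleton G \subset E') = [forall S, C S].
  apply/andP/forallP => [[/fintype.subsetP sE /fintype.subsetP sE'] S|h].
    by apply/andP; split; apply/implyP; [exact: sE | exact: sE'].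
  (* Every edge indexes a coordinate, so the conditions [C S] see all of [E] and of the skeleton. *)
  have card2 e : (e \in E) || (e \in skeleton G) -> (2 <= #|e|)%N.
    have /forall_inP dG2 := ugraph_skeleton dG.
    by case/orP=> [/(forall_inP EG)|/dG2] /eqP->.
  split; apply/fintype.subsetP => e eH.
    have e2 : (2 <= #|e|)%N by rewrite card2 ?eH.
    by have /andP[/implyP + _] := h (exist _ e e2); apply.
  have e2 : (2 <= #|e|)%N by rewrite card2 ?eH ?orbT.
  by have /andP[_ /implyP] := h (exist _ e e2); apply.
apply: leif_sum => S _; rewrite /edge_weight /C.
case: eqP => [S2|Sn2].
  rewrite char_imset_pair // /Order.leif.
  have /implyP := fintype.subsetP sEE' (val S).
  case: (val S \in E); case: (val S \in E'); case: (val S \in skeleton G) => //= _;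
    split; rewrite ?mulr1 ?mulr0 ?subr0 ?sub0r ?lexx ?eqxx ?ler01 ?lerN10 //;
    by rewrite ?oppr_eq0 ?oner_eq0 // eq_sym oner_eq0.
(* Off the pairs, both terms vanish and [C S] holds vacuously. *)
have notin H : ugraph H -> (val S \in H) = false.
  by move=> /forall_inP HG; apply/negP => /HG/eqP.
by rewrite mul0r (notin E EG) (notin _ (ugraph_skeleton dG)); apply: leif_refl.
Qed.

End EdgeFunctional.

Theorem proposition2p4 (R : realType) (p : nat) (p_gt0 : (0 < p)%N)
    (E E' : {set {set 'I_p}}) (EG : ugraph E) (EG' : ugraph E')
    (sEE' : E \subset E') :
  is_face
    (conv_hull (char_imset R @`
       [set G : {set 'I_p * 'I_p} | dag G /\
          exists D : {set {set 'I_p}},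
            [/\ ugraph D, skeleton G = D, E \subset D & D \subset E']]))
    (CIM R p).
Proof.
have maxE := edge_functional_max R EG sEE'.
set B := (X in conv_hull X); set f := pairing (edge_weight R E E').
(* The graph [D] can only be [skeleton G], so the two inclusions are the equality case of [maxE]. *)
have -> : B = [set a | (char_imset R @` [set G | dag G]) a /\
                       f a = edge_bound R E].
  apply/seteqP; split=> a.
    move=> [G [dG [D [_ <- sED sDE']]] <-{a}]; split; first by exists G.
    by apply/eqP; rewrite (maxE G dG) sED.
  move=> [[G dG <-{a}] /eqP]; rewrite (maxE G dG) => /andP[sED sDE'].
  exists G => //; split=> //; exists (skeleton G).
  by split=> //; exact: ugraph_skeleton.
apply: (@is_face_conv_hull _ _ _ f _ (char_imset R (order_orientation E))).
- by move=> _ [G dG <-]; rewrite (maxE G dG).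
- by exists (order_orientation E) => //; exact: dag_order_orientation.
- apply/eqP; rewrite (maxE _ (@dag_order_orientation _ E)).
  by rewrite skeleton_order_orientation ?subxx.
Qed.
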